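(* For every $n\ge 1$, $$p_n^{\prime}(\mathbb{Q}_{\text{Monge}}^{\textsf{pop}}) = p_{n-1}(\mathbb{Q}_{\text{Monge}}^{\textsf{pop}}) + \frac13\sum_{j=2}^{\lfloor (n-1)/2\rfloor} p_{2j+1}^{1}(\mathbb{Q}_{\text{Monge}}^{\textsf{pop}})\,p_{n-(2j+1)}(\mathbb{Q}_{\text{Monge}}^{\textsf{pop}})$$ and $$p_n^{\prime}(\mathbb{Q}_{\text{In-sh}}^{\textsf{pop}}) \le p_{n-1}(\mathbb{Q}_{\text{In-sh}}^{\textsf{pop}}) + \frac13\sum_{j=2}^{\lfloor (n-1)/2\rfloor} p_{2j+1}^{1}(\mathbb{Q}_{\text{In-sh}}^{\textsf{pop}})\,p_{n-(2j+1)}(\mathbb{Q}_{\text{In-sh}}^{\textsf{pop}}).$$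
   Context: Permutations are written in one-line notation; $S_n$ is the set of permutations of $[n]=\{1,\dots,n\}$, $id_n = 12\cdots n$, and $\varepsilon$ is the empty sequence. A shuffling method $\Sigma$ is a family of sets $\Pi_{\Sigma}^{n}\subseteq S_n$, $n\ge 2$. The In-shuffle method is given by the single-element sets $\Pi_{\text{In-sh}}^{2k}=\{(k+1)\,1\,(k+2)\,2\cdots(2k)\,k\}$ and $\Pi_{\text{In-sh}}^{2k+1}=\{(k+1)\,1\,(k+2)\,2\cdots(2k)\,k\,(2k+1)\}$. The Monge method is given by the single-element sets $\Pi_{\text{Monge}}^{n}=\{\cdots 6\,4\,2\,1\,3\,5\cdots\}$, i.e. the even numbers of $[n]$ in decreasing order followed by the odd numbers of $[n]$ in increasing order. The pop shuffle queue $\mathbb{Q}_{\Sigma}^{\textsf{pop}}$ processes configurations $(s_{inp},s_{dev},s_{out})$ of three sequences (input, content of the device, output), starting from $(\pi,\varepsilon,\varepsilon)$ and ending at $(\varepsilon,\varepsilon,\pi')$, using freely chosen operations: push (move the first element of the input to the end of $s_{dev}$); pop (append the entire non-empty content $s_{dev}$, in order, to the end of the output, leaving the device empty); shuffle (if $s_{dev}=s_1\cdots s_m$ with $m\ge2$, choose $\sigma\in\Pi_{\Sigma}^{m}$ and replace the content by $s_{\sigma(1)}\cdots s_{\sigma(m)}$). A shuffle may not be applied immediately after another shuffle. $S_n(\mathbb{Q}_{\Sigma}^{\textsf{pop}})$ is the set of $\pi\in S_n$ for which the final output $\pi'=id_n$ can be achieved, and $p_n(\mathbb{Q}_{\Sigma}^{\textsf{pop}})=|S_n(\mathbb{Q}_{\Sigma}^{\textsf{pop}})|$,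 with $p_0(\mathbb{Q}_{\Sigma}^{\textsf{pop}})=1$ (the empty permutation). $p_n^{1}(\mathbb{Q}_{\Sigma}^{\textsf{pop}})$ is the number of $\pi\in S_n$ for which output $id_n$ can be achieved using exactly one pop operation. $p_n^{\prime}(\mathbb{Q}_{\Sigma}^{\textsf{pop}})=|\{\pi\in S_n(\mathbb{Q}_{\Sigma}^{\textsf{pop}}) : \pi_n=n\}|$. *)

(* Defs.v *)
From HB Require Import structures.
From mathcomp Require Import all_boot all_order all_algebra all_fingroup.
From mathcomp Require Import boolp.

Set Implicit Arguments.
Unset Strict Implicit.
Unset Printing Implicit Defensive.

(* 'S_n permutes {0,..,n-1}; words use the values 1,..,n. *)
Definition one_line (n : nat) (s : 'S_n) : seq nat :=
  [seq (s i).+1 | i <- enum 'I_n].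

(* The members of index < 2 are never used, see StepShuffle. *)
Definition shuffling_method : Type := forall n : nat, {set 'S_n}.

Definition insh_word (n : nat) : seq nat :=
  flatten [seq [:: n./2 + i; i] | i <- iota 1 n./2]
    ++ (if odd n then [:: n] else [::]).

Definition monge_word (n : nat) : seq nat :=
  rev [seq i <- iota 1 n | ~~ odd i] ++ [seq i <- iota 1 n | odd i].

Definition InSh : shuffling_method :=
  fun n => [set s : 'S_n | one_line s == insh_word n].

Definition Monge : shuffling_method :=
  fun n => [set s : 'S_n | one_line s == monge_word n].

Inductive op := Push | Pop | Shuffle.

Definition is_pop (o : op) : bool := if o is Pop then true else false.

Definition is_shuffle (o : op) : bool := if o is Shuffle then true else false.

(* (input, device, output) *)
Definition config : Type := (seq nat * seq nat * seq nat)%type.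

Inductive step (Sigma : shuffling_method) : op -> config -> config -> Prop :=
| StepPush x inp dev out :
    step Sigma Push (x :: inp, dev, out) (inp, rcons dev x, out)
| StepPop inp dev out : dev <> [::] ->
    step Sigma Pop (inp, dev, out) (inp, [::], out ++ dev)
| StepShuffle inp m (dev : m.-tuple nat) out (s : 'S_m) :
    2 <= m -> s \in Sigma m ->
    step Sigma Shuffle (inp, tval dev, out)
      (inp, [seq tnth dev (s i) | i <- enum 'I_m], out).

Inductive run (Sigma : shuffling_method) : seq op -> config -> config -> Prop :=
| RunNil c : run Sigma [::] c c
| RunCons o os c1 c2 c3 :
    step Sigma o c1 c2 -> run Sigma os c2 c3 -> run Sigma (o :: os) c1 c3.

Definition no_double_shuffle (os : seq op) : bool :=
  sorted (fun o1 o2 => ~~ (is_shuffle o1 && is_shuffle o2)) os.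

Definition sorts (Sigma : shuffling_method) (os : seq op) (n : nat) (s : 'S_n)
    : Prop :=
  no_double_shuffle os /\
  run Sigma os (one_line s, [::], [::]) ([::], [::], iota 1 n).

Definition sortable (Sigma : shuffling_method) (n : nat) : {set 'S_n} :=
  [set s : 'S_n | `[< exists os, sorts Sigma os s >]].

Definition sortable1 (Sigma : shuffling_method) (n : nat) : {set 'S_n} :=
  [set s : 'S_n | `[< exists2 os, sorts Sigma os s & count is_pop os = 1 >]].

Definition p (Sigma : shuffling_method) (n : nat) : nat := #|sortable Sigma n|.

Definition p1 (Sigma : shuffling_method) (n : nat) : nat :=
  #|sortable1 Sigma n|.

(* Meaningful for n >= 1: the n-th entry of the word sits at index n.-1. *)
Definition p' (Sigma : shuffling_method) (n : nat) : nat :=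
  #|[set s in sortable Sigma n | nth 0 (one_line s) n.-1 == n]|.

(* The words above are one-line notations, so InSh n and Monge n are indeed
   singletons. *)
Lemma card_word_set (n : nat) (w : seq nat) :
  perm_eq w (iota 1 n) -> #|[set s : 'S_n | one_line s == w]| = 1.
Proof.
move=> pw; have sw : size w = n by rewrite (perm_size pw) size_iota.
have uw : uniq w by rewrite (perm_uniq pw) iota_uniq.
have w_bnd (i : 'I_n) : 0 < nth 0 w i <= n.
  have : nth 0 w i \in iota 1 n by rewrite -(perm_mem pw) mem_nth ?sw.
  by rewrite mem_iota add1n ltnS.
have ltw (i : 'I_n) : (nth 0 w i).-1 < n.
  by have /andP[w0 wn] := w_bnd i; rewrite prednK.
pose f (i : 'I_n) := Ordinal (ltw i).
have f_inj : injective f.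
  move=> i j /(congr1 val) /= eq_ij; apply/val_inj/eqP => /=.
  rewrite -(nth_uniq 0 _ _ uw) ?sw //; apply/eqP.
  have /andP[wi _] := w_bnd i; have /andP[wj _] := w_bnd j.
  by rewrite -(prednK wi) -(prednK wj) eq_ij.
have onE (s : 'S_n) (i : 'I_n) : nth 0 (one_line s) i = (s i).+1.
  by rewrite (nth_map i) ?size_enum_ord // nth_ord_enum.
have s_w : one_line (perm f_inj) = w.
  apply: (@eq_from_nth _ 0); first by rewrite size_map size_enum_ord sw.
  move=> i; rewrite size_map size_enum_ord => lt_in.
  rewrite (onE _ (Ordinal lt_in)) permE /= prednK //.
  by have /andP[] := w_bnd (Ordinal lt_in).
apply/eqP/cards1P; exists (perm f_inj); apply/setP => s; rewrite !inE.
apply/eqP/eqP => [s_w' | -> //]; apply/permP => i; apply: val_inj.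
by apply: succn_inj; rewrite -!onE s_w s_w'.
Qed.

Lemma card_Monge (n : nat) : #|Monge n| = 1.
Proof.
apply: card_word_set; rewrite /monge_word perm_catC.
apply: perm_trans (permEl (perm_filterC odd (iota 1 n))).
by rewrite perm_cat2l perm_rev.
Qed.

Lemma card_InSh (n : nat) : #|InSh n| = 1.
Proof.
apply: card_word_set; rewrite /insh_word; set k := n./2.
have perm_fl (r : seq nat) :
    perm_eq (flatten [seq [:: k + i; i] | i <- r]) (r ++ [seq k + i | i <- r]).
  elim: r => //= i r IHr.
  rewrite -cat1s -[i :: flatten _]cat1s -[i :: _ ++ _]cat1s perm_catCA.
  by rewrite perm_cat2l perm_sym perm_catC /= perm_cons perm_catC perm_sym.
have -> : iota 1 n =
    (iota 1 k ++ [seq k + i | i <- iota 1 k]) ++ (if odd n then [:: n] else [::]).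
  rewrite -iotaDl addn1 -{1}(odd_double_half n) -/k -addnn addnC !iotaD add1n.
  congr (_ ++ _); case: ifP => //= odd_n.
  by rewrite addnn -[in RHS](odd_double_half n) odd_n.
by rewrite perm_cat2r.
Qed.

Lemma p_0 (Sigma : shuffling_method) : p Sigma 0 = 1.
Proof.
rewrite /p (_ : sortable Sigma 0 = [set: 'S_0]) ?cardsT ?card_Sn //.
apply/setP => s; rewrite !inE; apply/asboolP; exists [::]; split => //.
rewrite (_ : one_line s = [::]); first exact: RunNil.
by apply/size0nil; rewrite size_map size_enum_ord.
Qed.

(* Main.v *)
Require Import Defs.
From HB Require Import structures.
From mathcomp Require Import all_boot all_order all_algebra all_fingroup.
From mathcomp Require Import boolp.
From mathcomp Require Import zify.
Import Order.TTheory GRing.Theory Num.Theory.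

Set Implicit Arguments.
Unset Strict Implicit.
Unset Printing Implicit Defensive.

(** The content of the device is pushed and popped in order, so a permutation
is sortable exactly when it is a direct sum of blocks, a block being a
permutation that can be sorted with a single pop ([sortsP]).  Both methods fix
the last position in odd sizes: the shuffle of size 2j+1 is the shuffle
[sigma] of size 2j followed by a fixed point.  Hence a block of size 2j+1 has
the form w (2j+1), where, writing [f] for a device content reachable just
after the last letter of [w] is pushed, the device must become sorted after
0, 1 or 2 applications of [sigma] to [f]: at most one at time 2j, and at most
one at time 2j+1.

Relabelling the values of [w] by [sigma] trades one such application for
another, so the three families of words [w] are equinumerous
([count_sorted_after]).  For j >= 2 they are disjoint, because neither [sigma]
nor its square fixes the last position, so that the last letter of [w]
tells the families apart ([sorted_after_disjoint]).  Each family therefore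
has a third of the p1(2j+1) elements.

Let v n be sortable, where the last letter n is the maximum.  Either v is
sortable, which accounts for p(n-1), or the last block has odd size 2j+1 with
j >= 2 and its word [w] lies in the third family, the only one whose members
need two shuffles after the last push ([exceptional_tail]).  Then v is the
direct sum of a sortable permutation and of [w].  Counting these pairs gives
the upper bound for any such method ([p'_upper]).

Equality holds when distinct pairs give distinct v, none of them sortable
([p'_exact]).  For the Monge shuffle a word [w] of the third family ends with
the letters 1 and j+1 ([sorted_after2_tail]).  The last letter of v then
determines j.  Moreover a Monge block ends with its maximum or its minimum
([block_last]), so a last block of v would have size j and its minimum at the
end, while the 1 of [w], which is smaller, stands just before it inside the
same block.  So v is not sortable. *)

(** * Permutations as words *)

Definition words (n : nat) : seq (seq nat) := permutations (iota 1 n).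

Lemma mem_words n w : (w \in words n) = perm_eq w (iota 1 n).
Proof. exact: mem_permutations. Qed.

Lemma words_uniq n : uniq (words n).
Proof. exact: permutations_uniq. Qed.

Lemma size_word n w : w \in words n -> size w = n.
Proof. by rewrite mem_words => /perm_size->; rewrite size_iota. Qed.

Lemma uniq_word n w : w \in words n -> uniq w.
Proof. by rewrite mem_words => /perm_uniq->; rewrite iota_uniq. Qed.

Lemma mem_word n w x : w \in words n -> (x \in w) = (0 < x <= n).
Proof. by rewrite mem_words => /perm_mem->; rewrite mem_iota; lia. Qed.

Lemma iota1_rcons n : iota 1 n.+1 = rcons (iota 1 n) n.+1.
Proof. by rewrite -(addn1 n) iotaD cats1 add1n addn1. Qed.

Lemma rcons_word n w : (rcons w n.+1 \in words n.+1) = (w \in words n).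
Proof. by rewrite !mem_words iota1_rcons -!cats1 perm_cat2r. Qed.

Lemma one_line_word n (s : 'S_n) : one_line s \in words n.
Proof.
rewrite mem_words /one_line -[X in iota X]addn0 iotaDl.
rewrite (map_comp succn (fun i => val (s i))) perm_map //.
rewrite (map_comp val s) -val_enum_ord perm_map //.
apply: uniq_perm; rewrite ?(map_inj_uniq perm_inj) ?enum_uniq //.
move=> i; rewrite mem_enum; apply/mapP; exists (s^-1 i)%g; rewrite ?mem_enum //.
by rewrite permKV.
Qed.

Lemma card_one_line (P : pred (seq nat)) n :
  #|[set s : 'S_n | P (one_line s)]| = count P (words n).
Proof.
have inj_ol : injective (@one_line n).
  move=> s1 s2 E; apply/permP => i; apply: val_inj; apply: succn_inj.
  by move/eq_in_map: E => /(_ i); rewrite mem_enum => ->.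
rewrite cardE -size_filter -(size_map (@one_line n)); apply: perm_size.
apply: uniq_perm; rewrite ?map_inj_uniq ?enum_uniq ?filter_uniq ?words_uniq //.
move=> w; rewrite mem_filter; apply/mapP/andP => [[s]|[Pw]].
  by rewrite mem_enum inE => Ps ->; rewrite Ps one_line_word.
rewrite mem_words => /card_word_set/eqP/cards1P[s Es].
have : s \in [set s] by rewrite inE.
rewrite -Es inE => /eqP sw; by exists s; rewrite // mem_enum inE sw.
Qed.

Lemma count_words_rcons (P : pred (seq nat)) n :
  {in words n.+1, forall w : seq nat, P w -> nth 0 w n = n.+1} ->
  count P (words n.+1) = count (fun w => P (rcons w n.+1)) (words n).
Proof.
move=> lastP; rewrite -!size_filter -[RHS](size_map (rcons^~ n.+1)).
apply/perm_size/uniq_perm; rewrite ?map_inj_uniq ?filter_uniq ?words_uniq //.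
  by move=> w1 w2 /rcons_inj[].
move=> w; rewrite mem_filter; apply/andP/mapP => [[Pw ww]|[v]]; last first.
  by rewrite mem_filter => /andP[Pv wv] ->; rewrite rcons_word.
have := lastP w ww Pw; elim/last_ind: w Pw ww => [|v x _] Pw ww.
  by have := size_word ww.
have sv : size v = n by have := size_word ww; rewrite size_rcons => -[].
rewrite nth_rcons sv ltnn eqxx => Ex; rewrite Ex in Pw ww.
by exists v; rewrite ?Ex // mem_filter Pw -rcons_word.
Qed.

(** * Shuffling positions, relabelling values *)

Section Shuffling.

Context (W : nat -> seq nat) (wordW : forall n, W n \in words n).

Definition word_method : shuffling_method :=
  fun n => [set s : 'S_n | one_line s == W n].

Definition shuffle (d : seq nat) : seq nat :=
  [seq nth 0 d i.-1 | i <- W (size d)].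

Lemma size_shuffle d : size (shuffle d) = size d.
Proof. by rewrite size_map (size_word (wordW _)). Qed.

Lemma nth_shuffle d i : i < size d ->
  nth 0 (shuffle d) i = nth 0 d (nth 0 (W (size d)) i).-1.
Proof. by move=> lt_id; rewrite (nth_map 0) ?(size_word (wordW _)). Qed.

Lemma shuffle_map f d : shuffle (map f d) = map f (shuffle d).
Proof.
rewrite /shuffle size_map -map_comp; apply/eq_in_map => i /=.
by rewrite (mem_word _ (wordW _)) => /andP[i0 id]; rewrite (nth_map 0) ?prednK.
Qed.

Lemma shuffle_inj d1 d2 :
  size d1 = size d2 -> shuffle d1 = shuffle d2 -> d1 = d2.
Proof.
rewrite /shuffle => eqs; rewrite -eqs => /eq_in_map eqd.
apply: (@eq_from_nth _ 0) => // i lt_i.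
by apply: (eqd i.+1); rewrite (mem_word _ (wordW _)).
Qed.

Lemma perm_shuffle d : perm_eq (shuffle d) d.
Proof.
have {2}<- : [seq nth 0 d i.-1 | i <- iota 1 (size d)] = d.
  by rewrite -[1]addn0 iotaDl -map_comp -[RHS](mkseq_nth 0).
by apply: perm_map; rewrite -mem_words wordW.
Qed.

Definition relabel n x := nth 0 (W n) x.-1.

Lemma map_relabel_iota n : map (relabel n) (iota 1 n) = W n.
Proof.
rewrite -[1]addn0 iotaDl -map_comp -[RHS](mkseq_nth 0).
by rewrite (size_word (wordW _)).
Qed.

Lemma shuffle_iota n : shuffle (iota 1 n) = W n.
Proof.
rewrite /shuffle size_iota -[RHS]map_id; apply/eq_in_map => i.
rewrite (mem_word _ (wordW _)) => /andP[i0 lt_i].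
by rewrite nth_iota ?add1n prednK.
Qed.

Lemma relabel_inj n : {in iota 1 n &, injective (relabel n)}.
Proof.
move=> x y; rewrite !mem_iota => lx ly /eqP.
rewrite nth_uniq ?(uniq_word (wordW n)) ?(size_word (wordW n)) //;
  try lia; move/eqP; lia.
Qed.

(** Shuffling composes a word with [W] on the positions, relabelling composes
it with [W] on the values, and a one-sided inverse of a permutation is
two-sided. *)
Lemma relabel_eq_iota n e : e \in words n ->
  (iota 1 n == map (relabel n) e) = (iota 1 n == shuffle e).
Proof.
move=> we; have se := size_word we.
have inj: {in iota 1 n &, injective (relabel n)} by apply: relabel_inj.
apply/eqP/eqP => [eq1|eq2].
- have := congr1 shuffle eq1; rewrite shuffle_iota shuffle_map -map_relabel_iota.
  have: perm_eq (shuffle e) (iota 1 n).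
    by apply: perm_trans (perm_shuffle e) _; rewrite -mem_words.
  move: (shuffle e) => v pv eqm; apply: (@eq_from_nth _ 0) => [|i lt_i].
    by rewrite (perm_size pv).
  have lt_iv : i < size v by rewrite (perm_size pv).
  have := congr1 (nth 0 ^~ i) eqm; rewrite !(nth_map 0) //.
  by apply: inj; [exact: mem_nth | rewrite -(perm_mem pv) mem_nth].
- apply: shuffle_inj; first by rewrite size_map size_iota.
  by rewrite shuffle_map -eq2 shuffle_iota map_relabel_iota.
Qed.

(** * Device contents *)

(** The device contents reachable by pushing the whole of [w] when the last
operation is the last push; the empty shuffle of an empty device is harmless.
Since two shuffles may not be adjacent, at most one shuffle follows each
push, hence [devices]. *)
Definition fresh (w : seq nat) : seq (seq nat) :=
  foldl (fun ds x => [seq rcons d x | d <- ds ++ map shuffle ds]) [:: [::]] w.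

Definition devices (w : seq nat) : seq (seq nat) :=
  fresh w ++ map shuffle (fresh w).

Lemma fresh_rcons w x : fresh (rcons w x) = [seq rcons d x | d <- devices w].
Proof. by rewrite /fresh foldl_rcons. Qed.

Lemma map_shuffle_map f ds :
  map shuffle (map (map f) ds) = map (map f) (map shuffle ds).
Proof. by rewrite -!map_comp; apply: eq_map => d /=; apply: shuffle_map. Qed.

(** Shuffles only look at positions.  This is what lets a block be studied up
to a shift of its values, and words be relabelled by [W]. *)
Lemma fresh_map f w : fresh (map f w) = map (map f) (fresh w).
Proof.
elim/last_ind: w => [//|w x IHw]; rewrite map_rcons !fresh_rcons /devices IHw.
rewrite map_shuffle_map -map_cat -!map_comp; apply: eq_map => d /=.
by rewrite map_rcons.
Qed.

Lemma devices_map f w : devices (map f w) = map (map f) (devices w).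
Proof. by rewrite /devices fresh_map map_shuffle_map -map_cat. Qed.

Lemma perm_fresh w d : d \in fresh w -> perm_eq d w.
Proof.
elim/last_ind: w d => [|w x IHw] d; first by rewrite inE => /eqP->.
rewrite fresh_rcons => /mapP[e e_w ->]; rewrite -!cats1 perm_cat2r.
move: e_w; rewrite mem_cat => /orP[/IHw//|/mapP[f /IHw pf ->]].
exact: perm_trans (perm_shuffle f) pf.
Qed.

Lemma perm_devices w d : d \in devices w -> perm_eq d w.
Proof.
rewrite mem_cat => /orP[/perm_fresh//|/mapP[f /perm_fresh pf ->]].
exact: perm_trans (perm_shuffle f) pf.
Qed.

(** * Direct sums of blocks *)

Definition block (w : seq nat) : bool := iota 1 (size w) \in devices w.

Lemma block_word w : block w -> w \in words (size w).
Proof. by move=> /perm_devices; rewrite mem_words perm_sym. Qed.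

Definition dsum (u w : seq nat) : seq nat := u ++ map (addn (size u)) w.

Lemma size_dsum u w : size (dsum u w) = size u + size w.
Proof. by rewrite size_cat size_map. Qed.

Lemma dsum0 u : dsum u [::] = u.
Proof. exact: cats0. Qed.

Lemma dsum0l w : dsum [::] w = w.
Proof. by rewrite /dsum /= -[RHS]map_id. Qed.

Lemma dsum_rcons u w x : dsum u (rcons w x) = rcons (dsum u w) (size u + x).
Proof. by rewrite /dsum map_rcons rcons_cat. Qed.

Lemma dsum_word m n u w :
  u \in words m -> w \in words n -> dsum u w \in words (m + n).
Proof.
move=> wu ww; rewrite mem_words /dsum (size_word wu) iotaD addnC iotaDl.
by rewrite perm_cat -?mem_words // perm_map -?mem_words.
Qed.

Lemma dsum_inj u1 w1 u2 w2 : size u1 = size u2 ->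
  dsum u1 w1 = dsum u2 w2 -> u1 = u2 /\ w1 = w2.
Proof.
move=> eqs /eqP; rewrite /dsum eqseq_cat // eqs => /andP[/eqP-> /eqP eqw].
split=> //.
by apply: inj_map eqw; apply: addnI.
Qed.

(** The number of blocks is recorded because it is the number of pops; the
last block is the exposed one because the theorem is about the last letter. *)
Inductive splits : nat -> seq nat -> Prop :=
| SplitNil : splits 0 [::]
| SplitBlock k u w :
    splits k u -> w <> [::] -> block w -> splits k.+1 (dsum u w).

Lemma splits_word k w : splits k w -> w \in words (size w).
Proof.
elim=> // {k w} k u w _ wu _ /block_word ww.
by rewrite size_dsum dsum_word.
Qed.

(** * Runs of the queue *)

(** Starting the path at a non-shuffle operation gives [no_double_shuffle], and
this form concatenates. *)
Local Notation separated :=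
  (path (fun o1 o2 => ~~ (is_shuffle o1 && is_shuffle o2))).

Lemma shuffle_small d : size d <= 1 -> shuffle d = d.
Proof. by move=> sd; apply: perm_small_eq (perm_shuffle d). Qed.

Lemma map_tnth_one_line m (dev : m.-tuple nat) (s : 'S_m) :
  s \in word_method m ->
  [seq tnth dev (s i) | i <- enum 'I_m] = shuffle dev.
Proof.
rewrite inE /shuffle size_tuple => /eqP <-; rewrite /one_line -map_comp.
by apply: eq_map => i /=; rewrite (tnth_nth 0).
Qed.

Lemma step_shuffle inp dev out c :
  step word_method Shuffle (inp, dev, out) c -> c = (inp, shuffle dev, out).
Proof.
move=> st; inversion st as [| |inp' m dev' out' s _ sS E1 E2]; subst.
by rewrite map_tnth_one_line.
Qed.

Lemma shuffle_step inp dev out : 2 <= size dev ->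
  step word_method Shuffle (inp, dev, out) (inp, shuffle dev, out).
Proof.
move=> s2; have := wordW (size dev).
rewrite mem_words => /card_word_set/eqP/cards1P[s Es].
have sS : s \in word_method (size dev) by rewrite /word_method Es inE.
have := @StepShuffle word_method inp _ (in_tuple dev) out s s2 sS.
by rewrite map_tnth_one_line.
Qed.

Lemma run_cat os1 os2 c1 c2 c3 :
  run word_method os1 c1 c2 -> run word_method os2 c2 c3 ->
  run word_method (os1 ++ os2) c1 c3.
Proof. by elim=> //= o os d1 d2 d3 st _ IH /IH; apply: RunCons. Qed.

Lemma run_output os c1 c2 :
  run word_method os c1 c2 -> exists t, c2.2 = c1.2 ++ t.
Proof.
elim=> {os c1 c2} [c|o os d1 d2 d3 st _ [t ->]].
  by exists [::]; rewrite cats0.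
case: st => /= [x inp dev out|inp dev out _|inp m dev out s _ _].
- by exists t.
- by exists (dev ++ t); rewrite catA.
- by exists t.
Qed.

Lemma sub_fresh w d : d \in fresh w -> d \in devices w.
Proof. by rewrite mem_cat => ->. Qed.

Lemma dsum_block u v : iota (size u).+1 (size v) \in devices v ->
  exists2 w, u ++ v = dsum u w & block w.
Proof.
move=> dv; exists [seq x - size u | x <- v].
  rewrite /dsum -map_comp -[in LHS](map_id v); congr (_ ++ _).
  apply/eq_in_map => x xv /=; rewrite subnKC //.
  by move: xv; rewrite -(perm_mem (perm_devices dv)) mem_iota => /andP[/ltnW].
rewrite /block devices_map // size_map; apply/mapP.
exists (iota (size u).+1 (size v)) => //.
rewrite -(addn1 (size u)) iotaDl -map_comp -[LHS]map_id; apply: eq_map => x /=.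
by rewrite addKn.
Qed.

(** Invariant of a successful run: [u] is the part of the input already
popped, [v] the part in the device.  As the output only grows and ends as the
identity, each popped content must continue the identity, so the popped part
of the input is a block shifted by the size of [u]. *)
Lemma run_splits os last inp dev u v n k :
  separated last os ->
  run word_method os (inp, dev, iota 1 (size u)) ([::], [::], iota 1 n) ->
  splits k u ->
  dev \in (if is_shuffle last then devices v else fresh v) ->
  splits (k + count is_pop os) (u ++ v ++ inp).
Proof.
elim: os last inp dev u v k => [|o os IH] last inp dev u v k sep r su dv.
  inversion r; subst.
  have : [::] \in devices v by case: ifP dv => // _ /sub_fresh.
  by move/perm_devices; rewrite perm_sym => /perm_nilP-> /=; rewrite addn0 cats0.
have dv' : dev \in devices v by case: ifP dv => // _ /sub_fresh.
inversion r as [|o' os' c1 c2 c3 st r']; subst => {r}.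
move: sep => /= /andP[sepo sep].
case: o st sepo sep => st sepo sep.
- inversion st as [x inp' dev' out'| |]; subst.
  have := IH Push inp' (rcons dev x) u (rcons v x) k sep r' su.
  by rewrite cat_rcons; apply; rewrite /= fresh_rcons (map_f (rcons^~ x)).
- inversion st as [|inp' dev' out' dn0|]; subst.
  have szd : size dev = size v by rewrite (perm_size (perm_devices dv')).
  have Ed : iota 1 (size u) ++ dev = iota 1 (size u + size v).
    have [/= t Et] := run_output r'.
    have En : n = size u + size v + size t.
      by rewrite -(size_iota 1 n) Et !size_cat size_iota szd.
    move: Et; rewrite En [in LHS]iotaD => /eqP; rewrite eqseq_cat.
      by move=> /andP[/eqP-> _].
    by rewrite size_cat !size_iota szd.
  move: (Ed); rewrite iotaD => /eqP; rewrite eqseq_cat // => /andP[_ /eqP Ed'].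
  rewrite Ed' add1n in dv'; have [w Ew bw] := dsum_block dv'.
  have szw : size v = size w.
    by move: (congr1 size Ew); rewrite size_cat size_dsum => /addnI.
  have wn0 : w <> [::].
    by move=> w0; apply: dn0; apply/size0nil; rewrite szd szw w0.
  have := IH Pop inp [::] (dsum u w) [::] k.+1 sep.
  rewrite size_dsum -szw -Ed => /(_ r' (SplitBlock su wn0 bw) (mem_head _ _)).
  by rewrite /= -Ew -catA addSnnS.
- case/step_shuffle: (st) => Ec; rewrite Ec in r'.
  have := IH Shuffle inp (shuffle dev) u v k sep r' su.
  apply; rewrite mem_cat; apply/orP; right; apply: map_f.
  by move: sepo; rewrite /= andbT => /negPf Hl; rewrite Hl in dv.
Qed.

(** The induction step common to [fresh_run] and [devices_run]; a device of
size at most 1 is left unchanged rather than shuffled. *)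
Lemma devices_of_fresh_run w d inp out :
  (forall e, e \in fresh w -> exists2 os,
     run word_method os (w ++ inp, [::], out) (inp, e, out)
   & [/\ separated Pop os, count is_pop os = 0
     & ~~ is_shuffle (last Pop os)]) ->
  d \in devices w ->
  exists2 os, run word_method os (w ++ inp, [::], out) (inp, d, out)
    & separated Pop os /\ count is_pop os = 0.
Proof.
move=> IH; rewrite mem_cat => /orP[/IH[os r [sep c _]]|]; first by exists os.
move=> /mapP[e /IH[os r [sep c l]] ->].
case: (leqP (size e) 1) => [/shuffle_small->|s2]; first by exists os.
exists (rcons os Shuffle).
  rewrite -cats1; apply: run_cat r _.
  by apply: RunCons (shuffle_step _ _ s2) (RunNil _ _).
by rewrite rcons_path sep andbT l -cats1 count_cat c.
Qed.

Lemma fresh_run w d inp out : d \in fresh w ->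
  exists2 os, run word_method os (w ++ inp, [::], out) (inp, d, out)
    & [/\ separated Pop os, count is_pop os = 0 & ~~ is_shuffle (last Pop os)].
Proof.
elim/last_ind: w d inp => [|w x IH] d inp.
  by rewrite inE => /eqP->; exists [::] => //; apply: RunNil.
rewrite fresh_rcons => /mapP[e e_w ->]; rewrite cat_rcons.
have [os r [sep c]] := devices_of_fresh_run (fun e => IH e (x :: inp)) e_w.
exists (rcons os Push).
  rewrite -cats1; apply: run_cat r _.
  by apply: RunCons (StepPush _ _ _ _ _) (RunNil _ _).
by rewrite rcons_path sep last_rcons andbF -cats1 count_cat c.
Qed.

Lemma devices_run w d inp out : d \in devices w ->
  exists2 os, run word_method os (w ++ inp, [::], out) (inp, d, out)
    & separated Pop os /\ count is_pop os = 0.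
Proof. by apply: devices_of_fresh_run => e; apply: fresh_run. Qed.

Lemma splits_run k u inp : splits k u ->
  exists2 os,
    run word_method os (u ++ inp, [::], [::]) (inp, [::], iota 1 (size u))
    & [/\ separated Pop os, count is_pop os = k & last Pop os = Pop].
Proof.
move=> su; elim: su inp => [|{k u} k u w _ IH wn0 bw] inp.
  by exists [::] => //; apply: RunNil.
have [os1 r1 [sep1 c1 l1]] := IH (map (addn (size u)) w ++ inp).
have dw : iota (size u).+1 (size w) \in devices (map (addn (size u)) w).
  by rewrite devices_map // -(addn1 (size u)) iotaDl map_f.
have [os2 r2 [sep2 c2]] := devices_run inp (iota 1 (size u)) dw.
exists (os1 ++ rcons os2 Pop).
  rewrite /dsum -catA; apply: run_cat r1 _; rewrite -cats1; apply: run_cat r2 _.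
  have := StepPop word_method inp (iota 1 (size u))
    (dev := iota (size u).+1 (size w)).
  rewrite size_cat size_map iotaD add1n => stp.
  apply: RunCons (stp _) (RunNil _ _).
  by case: (w) wn0 => [[]|].
split; last by rewrite last_cat last_rcons.
  by rewrite cat_path sep1 l1 rcons_path sep2 andbF.
by rewrite -cats1 !count_cat c1 c2 /= addn1.
Qed.

Lemma sortsP n (s : 'S_n) k :
  (exists2 os, sorts word_method os s & count is_pop os = k)
  <-> splits k (one_line s).
Proof.
have sz : size (one_line s) = n by rewrite (size_word (one_line_word s)).
split=> [[os [sep r] <-]|/(splits_run [::])[os]].
  have sepP : separated Pop os by case: os sep {r}.
  have := run_splits (u := [::]) (v := [::]) sepP r SplitNil.
  by rewrite add0n; apply.
rewrite cats0 sz => r [sep c _]; exists os => //; split=> //.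
by case: os sep {r c} => //= o os /andP[].
Qed.

Lemma splits1 w : splits 1 w <-> w <> [::] /\ block w.
Proof.
split=> [sw|[wn0 bw]]; last first.
  by rewrite -[w]dsum0l; apply: SplitBlock => //; apply: SplitNil.
inversion sw as [|k u v su vn0 bv]; subst; inversion su; subst.
by rewrite dsum0l.
Qed.

(** * Counting words *)

Definition sortable_word w : bool := `[< exists k, splits k w >].

Lemma mem_sortable n (s : 'S_n) :
  (s \in sortable word_method n) = sortable_word (one_line s).
Proof.
rewrite inE; apply/asbool_equiv_eq; split=> [[os so]|[k sk]].
  by exists (count is_pop os); apply/sortsP; exists os.
by have [os so _] := (sortsP s k).2 sk; exists os.
Qed.

Lemma p_count n : p word_method n = count sortable_word (words n).
Proof.
by rewrite -card_one_line; apply: eq_card => s; rewrite mem_sortable inE.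
Qed.

Lemma p1_count n : p1 word_method n.+1 = count block (words n.+1).
Proof.
rewrite -card_one_line; apply: eq_card => s; rewrite !inE.
apply/asboolP/idP => [|bs].
  by move/(sortsP s)/splits1 => [].
apply/(sortsP s)/splits1; split=> // s0.
by have := size_word (one_line_word s); rewrite s0.
Qed.

Lemma p'_count n :
  p' word_method n.+1 = count (fun w => sortable_word (rcons w n.+1)) (words n).
Proof.
pose P w := sortable_word w && (nth 0 w n == n.+1).
have -> : p' word_method n.+1 = count P (words n.+1).
  by rewrite -card_one_line; apply: eq_card => s; rewrite inE mem_sortable inE.
rewrite count_words_rcons => [|w _ /andP[_ /eqP] //].
apply: eq_in_count => w ww.
by rewrite /P nth_rcons (size_word ww) ltnn eqxx eqxx andbT.
Qed.

Lemma count_relabel (P : pred (seq nat)) n :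
  count (preim (map (relabel n)) P) (words n) = count P (words n).
Proof.
have sub: {subset map (map (relabel n)) (words n) <= words n}.
  move=> _ /mapP[w ww ->]; rewrite mem_words.
  apply: perm_trans (_ : perm_eq (W n) _).
    by rewrite -map_relabel_iota perm_map // -mem_words.
  by rewrite -mem_words.
have uq : uniq (map (map (relabel n)) (words n)).
  rewrite map_inj_in_uniq ?words_uniq // => v1 v2 w1 w2 E.
  have inj := relabel_inj (n := n).
  apply: (@eq_from_nth _ 0) => [|i lt_i]; first by rewrite !(@size_word n).
  have lt_i2 : i < size v2 by rewrite (size_word w2) -(size_word w1).
  have := congr1 (nth 0 ^~ i) E; rewrite !(nth_map 0) //; apply: inj.
    by move: w1; rewrite mem_words => /perm_mem <-; rewrite mem_nth.
  by move: w2; rewrite mem_words => /perm_mem <-; rewrite mem_nth.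
have [|_ eqm] := uniq_min_size uq sub; first by rewrite size_map.
by rewrite -count_map; apply/seq.permP/uniq_perm => //; apply: words_uniq.
Qed.

(** * Blocks of odd size *)

(** The last push may be followed by [t] shuffles in a row: this is not a run
for [t = 2], but in an odd size the shuffle before and the shuffle after
the push of the maximum act together in this way. *)
Definition sorted_after t w : bool :=
  iota 1 (size w) \in map (iter t shuffle) (fresh w).

Lemma perm_iter_shuffle t d : perm_eq (iter t shuffle d) d.
Proof. by elim: t => //= t IH; apply: perm_trans (perm_shuffle _) IH. Qed.

(** Relabelling by [W] commutes with the shuffles, and for the final identity
it has the effect of one more of them. *)
Lemma sorted_after_relabel t n w : w \in words n ->
  sorted_after t (map (relabel n) w) = sorted_after t.+1 w.
Proof.
move=> ww; have sw := size_word ww; rewrite /sorted_after.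
rewrite size_map fresh_map // sw.
have eqv d : d \in fresh w ->
    (iota 1 n == iter t shuffle (map (relabel n) d))
    = (iota 1 n == iter t.+1 shuffle d).
  move=> dw.
  have -> : iter t shuffle (map (relabel n) d)
      = map (relabel n) (iter t shuffle d).
    by elim: t => //= t ->; rewrite shuffle_map.
  rewrite relabel_eq_iota // mem_words.
  apply: perm_trans (perm_iter_shuffle t d) _.
  by apply: perm_trans (perm_fresh dw) _; rewrite -mem_words.
rewrite -map_comp; apply/mapP/mapP => -[d dw] /eqP E; exists d => //; apply/eqP.
  by rewrite -eqv.
by rewrite /= eqv.
Qed.

Lemma count_sorted_after t n :
  count (sorted_after t) (words n) = count (sorted_after 0) (words n).
Proof.
elim: t => // t <-; rewrite -[RHS]count_relabel; apply: eq_in_count => w ww /=.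
by rewrite sorted_after_relabel.
Qed.

Lemma last_fresh w d : d \in fresh w -> last 0 d = last 0 w.
Proof.
case/lastP: w => [|w x]; first by rewrite inE => /eqP->.
by rewrite fresh_rcons => /mapP[e _ ->]; rewrite !last_rcons.
Qed.

(** A shuffle of odd size is that of the preceding even size with a fixed point
added at the end.  In even sizes neither the shuffle nor its square, seen as
permutations, fixes the last position, apart from the square of the
transposition. *)
Hypothesis oddW : forall j, W j.*2.+1 = rcons (W j.*2) j.*2.+1.
Hypothesis moves_last : forall j, 0 < j -> last 0 (W j.*2) != j.*2.
Hypothesis moves_last2 : forall j, 1 < j ->
  nth 0 (W j.*2) (last 0 (W j.*2)).-1 != j.*2.

Lemma shuffle_odd j d x :
  size d = j.*2 -> shuffle (rcons d x) = rcons (shuffle d) x.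
Proof.
move=> sd; rewrite /shuffle size_rcons sd oddW map_rcons nth_rcons sd ltnn eqxx.
congr rcons; apply/eq_in_map => i; rewrite (mem_word _ (wordW _)) => li.
by rewrite nth_rcons sd; case: ltnP => //; lia.
Qed.

Lemma last_shuffle j e :
  size e = j.*2 -> last 0 (shuffle e) = nth 0 e (last 0 (W j.*2)).-1.
Proof.
case: (posnP j) => [->|j0] se.
  have /size0nil-> : size (shuffle e) = 0 by rewrite size_shuffle.
  by rewrite (size0nil se) nth_nil.
rewrite -nth_last size_shuffle // nth_shuffle // ?se; last by lia.
by rewrite -nth_last (size_word (wordW _)).
Qed.

Lemma last_devices_odd j w y d : size w = j.*2 ->
  d \in devices (rcons w y) -> last 0 d = y.
Proof.
move=> sw; rewrite mem_cat => /orP[/last_fresh->|/mapP[f]].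
  by rewrite last_rcons.
rewrite fresh_rcons => /mapP[e ew ->] ->.
rewrite (@shuffle_odd j) ?last_rcons //.
by rewrite (perm_size (perm_devices ew)).
Qed.

Lemma last_W_bound j : 0 < j -> 0 < last 0 (W j.*2) <= j.*2.
Proof.
move=> j0; rewrite -(mem_word _ (wordW _)) -nth_last mem_nth //.
by rewrite (size_word (wordW _)); lia.
Qed.

Lemma last_shuffle_neq j e : 0 < j -> size e = j.*2 -> uniq e ->
  last 0 (shuffle e) != last 0 e.
Proof.
move=> j0 se ue; rewrite (last_shuffle se) -(nth_last 0 e) nth_uniq ?se //.
- by have := last_W_bound j0; have := moves_last j0; lia.
- by have := last_W_bound j0; lia.
- by lia.
Qed.

Lemma last_shuffle2_neq j e : 1 < j -> size e = j.*2 -> uniq e ->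
  last 0 (shuffle (shuffle e)) != last 0 e.
Proof.
move=> j1 se ue; have j0 := ltnW j1; have lb := last_W_bound j0.
rewrite (@last_shuffle j) ?size_shuffle // nth_shuffle ?se //; last by lia.
have : nth 0 (W j.*2) (last 0 (W j.*2)).-1 \in W j.*2.
  by rewrite mem_nth // (size_word (wordW _)); lia.
rewrite (mem_word _ (wordW _)) => lb2; have := moves_last2 j1.
by rewrite -(nth_last 0 e) nth_uniq ?se //; lia.
Qed.

(** A permutation of two elements is an involution. *)
Lemma shuffle2_small e : size e <= 2 -> shuffle (shuffle e) = e.
Proof.
rewrite leq_eqVlt => /orP[/eqP s2|s1]; last first.
  by rewrite !shuffle_small ?size_shuffle.
have W2 : W 2 = [:: 2; 1].
  have := @moves_last 1 isT; have := wordW 2; rewrite [words 2]/= !inE.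
  by case/orP=> /eqP->.
by case: e s2 => [|a [|b []]] //= _; rewrite /shuffle /= W2 /= W2.
Qed.

Lemma mem_map_rcons (ds : seq (seq nat)) d x y :
  (rcons d y \in map (rcons^~ x) ds) = (y == x) && (d \in ds).
Proof.
apply/mapP/andP => [[e eds /rcons_inj[-> ->]]|[/eqP-> dds]]; last by exists d.
by rewrite eqxx.
Qed.

(** The last letter stays last in an odd size, so it must be the maximum; the
optional shuffles before and after its push combine into at most two. *)
Lemma block_odd j w x : size w = j.*2 ->
  block (rcons w x) = (x == j.*2.+1)
    && [|| sorted_after 0 w, sorted_after 1 w | sorted_after 2 w].
Proof.
move=> sw; rewrite /block size_rcons sw iota1_rcons /devices fresh_rcons.
have -> : map shuffle [seq rcons d x | d <- devices w]
    = [seq rcons d x | d <- map shuffle (devices w)].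
  rewrite -!map_comp; apply/eq_in_map => d /perm_devices/perm_size sd /=.
  by apply: shuffle_odd; rewrite sd sw.
rewrite -map_cat mem_map_rcons eq_sym /devices map_cat -map_comp !mem_cat.
by rewrite /sorted_after sw map_id; congr andb; do 3!case: (_ \in _).
Qed.

(** Reachable contents [d] and [e] have the same last letter, the one pushed
last; were [w] in two families, one or two shuffles of [e] would give [d] and
so keep that letter at the end. *)
Lemma sorted_after_disjoint j s t w :
  1 < j -> w \in words j.*2 -> s < t <= 2 ->
  sorted_after s w -> ~~ sorted_after t w.
Proof.
move=> j1 ww st /mapP[d dw Ed]; apply/mapP => -[e ew Ee].
have sw := size_word ww; rewrite sw in Ed Ee.
have szf f : f \in fresh w -> size f = j.*2 by move/perm_fresh/perm_size->.
have uqf f : f \in fresh w -> uniq f.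
  by move/perm_fresh/perm_uniq->; apply: uniq_word ww.
have lde : last 0 e = last 0 d by rewrite !(last_fresh (w := w)).
have n1 := last_shuffle_neq (ltnW j1) (szf e ew) (uqf e ew).
have n2 := last_shuffle2_neq j1 (szf e ew) (uqf e ew).
have injs : shuffle d = shuffle (shuffle e) -> d = shuffle e.
  by apply: shuffle_inj; rewrite ?size_shuffle // !szf.
move: Ed; rewrite Ee => {Ee} E.
have [Ed|Ed] : d = shuffle e \/ d = shuffle (shuffle e).
- case: s t st E => [|[|s]] [|[|[|t]]] //= st E; try lia.
  + by left.
  + by right.
  + by left; apply: injs.
- by rewrite lde Ed eqxx in n1.
- by rewrite lde Ed eqxx in n2.
Qed.

Lemma p1_odd j :
  1 < j -> p1 word_method j.*2.+1 = 3 * count (sorted_after 2) (words j.*2).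
Proof.
move=> j1; rewrite p1_count count_words_rcons => [|w ww]; last first.
  case/lastP: w ww => [|w x] ww; first by have := size_word ww.
  have sw : size w = j.*2 by have := size_word ww; rewrite size_rcons => -[].
  by rewrite (block_odd x sw) nth_rcons sw ltnn eqxx => /andP[/eqP].
have -> : count (fun w => block (rcons w j.*2.+1)) (words j.*2)
    = count (predU (sorted_after 0) (predU (sorted_after 1) (sorted_after 2)))
        (words j.*2).
  by apply: eq_in_count => w ww; rewrite (block_odd _ (size_word ww)) eqxx.
have disj (P Q : pred (seq nat)) : {in words j.*2, forall w, P w -> ~~ Q w} ->
    count (predU P Q) (words j.*2)
    = count P (words j.*2) + count Q (words j.*2).
  move=> PQ; rewrite -count_predUI [X in _ = _ + X](_ : _ = 0) ?addn0 //.
  apply/eqP; rewrite -leqn0 leqNgt -has_count; apply/hasPn => w /PQ /=.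
  by case: (P w) => // /(_ isT).
rewrite !disj ?count_sorted_after; first by lia.
  by move=> w ww; apply: sorted_after_disjoint ww _.
by move=> w ww p0; rewrite /= negb_or !(sorted_after_disjoint j1 ww _ p0).
Qed.

Lemma sortable_dsum u w :
  sortable_word u -> w <> [::] -> block w -> sortable_word (dsum u w).
Proof.
move=> /asboolP[k su] w0 bw; apply/asboolP; exists k.+1.
exact: SplitBlock.
Qed.

Lemma sortable_rcons_max w :
  sortable_word w -> sortable_word (rcons w (size w).+1).
Proof.
move=> sw; have := @sortable_dsum w [:: 1] sw.
by rewrite -[[:: 1]]/(rcons [::] 1) dsum_rcons dsum0 addn1; apply.
Qed.

(** * Sortable words that end with their maximum *)

(** If the last block of [rcons v n.+1] has even size, or if at most one shuffle
follows the last push before the maximum, removing the maximum leaves a sortable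
word; so two shuffles follow it, and they must not cancel each other. *)
Lemma exceptional_tail n v : v \in words n ->
  sortable_word (rcons v n.+1) -> ~~ sortable_word v ->
  exists j u w, [/\ 1 < j <= n./2, u \in words (n - j.*2), w \in words j.*2,
    sortable_word u && sorted_after 2 w & v = dsum u w].
Proof.
move=> wv /asboolP[k sv] nsv.
inversion sv as [Ek E|k' u w' su w'0 bw' Ek E]; first by case: (v) E.
case/lastP: w' w'0 bw' E => // w x _ bw.
rewrite dsum_rcons => /rcons_inj[Ev Ex].
have sz : n = size u + size w by rewrite -(size_word wv) -Ev size_dsum.
have {Ex} Ex : x = (size w).+1 by lia.
have sbu : sortable_word u by apply/asboolP; exists k'.
have nbw : w <> [::] /\ ~~ block w.
  split; first by move=> w0; case/negP: nsv; rewrite -Ev w0 dsum0.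
  apply/negP => bw'; case/negP: nsv; rewrite -Ev.
  by case: (w) bw' => [_|a l]; [rewrite dsum0 | move=> bw'; apply: sortable_dsum].
have [w0 /negP nb] := nbw.
have ww : w \in words (size w).
  have := block_word bw; rewrite size_rcons Ex rcons_word; exact.
have := odd_double_half (size w); move: (size w)./2 => j.
case: (odd (size w)) => /= szw.
  (* Even block: without a final shuffle [v] would already be sortable; with
     one, the maximum, pushed last, would have left the last position. *)
  have := bw; rewrite /block mem_cat fresh_rcons size_rcons -Ex => /orP[].
    rewrite Ex iota1_rcons mem_map_rcons eqxx => /nb [].
  case/mapP => f /mapP[d dw Ef] E.
  have sf : size f = j.+1.*2.
    by rewrite Ef size_rcons (perm_size (perm_devices dw)) -szw add1n doubleS.
  have uf : uniq f.
    by rewrite -(perm_uniq (perm_shuffle f)) -E iota_uniq.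
  have := last_shuffle_neq (ltn0Sn j) sf uf.
  by rewrite -E Ef last_rcons Ex iota1_rcons last_rcons eqxx.
have szw' : size w = j.*2 by lia.
have p01 : ~~ sorted_after 0 w /\ ~~ sorted_after 1 w.
  split; apply/negP => pw; apply: nb; rewrite /block mem_cat;
    move: pw; rewrite /sorted_after.
    by rewrite map_id => ->.
  by move=> ->; rewrite orbT.
have p2 : sorted_after 2 w.
  by move: bw; rewrite (block_odd _ szw') (negPf p01.1) (negPf p01.2) => /andP[].
have j1 : 1 < j.
  rewrite ltnNge; apply/negP => j1; case: p01 => /negP np0 _; apply: np0.
  move: p2; rewrite /sorted_after.
  case/mapP => f fw Ef; apply/mapP; exists f => //; rewrite Ef /= shuffle2_small //.
  by rewrite (perm_size (perm_fresh fw)) szw' (leq_double _ 1).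
exists j, u, w; split=> //.
- by rewrite j1 /=; lia.
- by rewrite (_ : n - j.*2 = size u); [apply: splits_word su | lia].
- by rewrite -szw'.
- by rewrite sbu p2.
Qed.

Definition exceptional n : seq (seq nat) :=
  [seq dsum q.1 q.2 | j <- index_iota 2 n./2.+1,
     q <- [seq (u, w) | u <- [seq u <- words (n - j.*2) | sortable_word u],
                        w <- [seq w <- words j.*2 | sorted_after 2 w]]].

Lemma size_exceptional n : size (exceptional n) =
  \sum_(2 <= j < n./2.+1)
    count (sorted_after 2) (words j.*2) * p word_method (n - j.*2).
Proof.
rewrite size_allpairs_dep sumnE big_map; apply: eq_bigr => j _.
by rewrite size_allpairs !size_filter p_count mulnC.
Qed.

Lemma mem_exceptional n v : reflect
  (exists j u w, [/\ 1 < j <= n./2, u \in words (n - j.*2), w \in words j.*2,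
    sortable_word u && sorted_after 2 w & v = dsum u w]) (v \in exceptional n).
Proof.
apply: (iffP allpairsPdep) => [[j [q [jr /allpairsP[[u w] /= [+ + ->]] ->]]]|].
  rewrite !mem_filter => /andP[su wu] /andP[pw ww]; exists j, u, w; split=> //.
    by rewrite mem_index_iota ltnS in jr.
  by rewrite su pw.
case=> j [u [w [jr wu ww /andP[su pw] ->]]]; exists j, (u, w); split=> //.
  by rewrite mem_index_iota ltnS.
by apply/allpairsP; exists (u, w); rewrite !mem_filter su wu pw ww.
Qed.

Lemma p'_split n : p' word_method n.+1 = p word_method n +
  count (fun v => sortable_word (rcons v n.+1) && ~~ sortable_word v) (words n).
Proof.
rewrite p'_count p_count.
rewrite (eq_in_count (a2 := predU sortable_word
   (fun v => sortable_word (rcons v n.+1) && ~~ sortable_word v))).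
  rewrite -count_predUI [X in _ = _ + X](_ : _ = 0) ?addn0 //.
  apply/eqP; rewrite -leqn0 leqNgt -has_count; apply/hasPn => v _ /=.
  by case: sortable_word; rewrite ?andbF.
move=> v wv /=; case Ev: (sortable_word v); rewrite ?andbT //=.
by rewrite -{1}(size_word wv) sortable_rcons_max.
Qed.

Lemma p'_upper n : p' word_method n.+1 <= p word_method n +
  \sum_(2 <= j < n./2.+1)
    count (sorted_after 2) (words j.*2) * p word_method (n - j.*2).
Proof.
rewrite p'_split leq_add2l -size_exceptional -size_filter uniq_leq_size //.
  by rewrite filter_uniq ?words_uniq.
move=> v; rewrite mem_filter => /andP[/andP[sv nsv] wv].
by apply/mem_exceptional; apply: exceptional_tail.
Qed.

Lemma sorted_after2_block j w :
  size w = j.*2 -> sorted_after 2 w -> block (rcons w j.*2.+1).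
Proof. by move=> sw p2; rewrite (block_odd _ sw) eqxx p2 !orbT. Qed.

Lemma p'_exact n : uniq (exceptional n) ->
  {in exceptional n, forall v, ~~ sortable_word v} ->
  p' word_method n.+1 = p word_method n +
  \sum_(2 <= j < n./2.+1)
    count (sorted_after 2) (words j.*2) * p word_method (n - j.*2).
Proof.
move=> uE nE; rewrite p'_split -size_exceptional -size_filter; congr (_ + _).
apply/perm_size/uniq_perm; rewrite ?filter_uniq ?words_uniq // => v.
rewrite mem_filter; apply/idP/idP => [/andP[/andP[sv nsv] wv]|Ev].
  by apply/mem_exceptional; apply: exceptional_tail.
rewrite (nE _ Ev) andbT.
have /mem_exceptional[j [u [w [jn wu ww /andP[su p2] ->]]]] := Ev.
have En : n = n - j.*2 + j.*2 by lia.
rewrite [X in words X]En dsum_word // andbT.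
have -> : rcons (dsum u w) n.+1 = dsum u (rcons w j.*2.+1).
  by rewrite dsum_rcons (size_word wu) addnS -En.
apply: sortable_dsum => //; first by case: (w).
exact: sorted_after2_block (size_word ww) p2.
Qed.

Lemma third_of_sum n : (3%:R^-1 * \sum_(2 <= j < ((n.+1 - 1)./2).+1)
    (p1 word_method (2 * j + 1)%N)%:R
      * (p word_method (n.+1 - (2 * j + 1))%N)%:R)%R
  = (\sum_(2 <= j < n./2.+1)
       count (sorted_after 2) (words j.*2) * p word_method (n - j.*2))%:R%R :> rat.
Proof.
rewrite subn1 /= natr_sum mulr_sumr; apply: eq_big_nat => j /andP[j1 _].
rewrite mul2n addn1 subSS p1_odd // !natrM !mulrA.
by rewrite mulVf ?mul1r // pnatr_eq0.
Qed.

End Shuffling.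

(** * The In-shuffle and Monge methods *)

Lemma word_of_method (W : nat -> seq nat) n :
  #|word_method W n| = 1 -> W n \in words n.
Proof.
move=> /eqP/cards1P[s Es]; have : s \in word_method W n by rewrite Es inE.
by rewrite inE => /eqP <-; apply: one_line_word.
Qed.

Lemma insh_is_word n : insh_word n \in words n.
Proof. exact: word_of_method (card_InSh n). Qed.

Lemma insh_odd j : insh_word j.*2.+1 = rcons (insh_word j.*2) j.*2.+1.
Proof.
rewrite /insh_word /= odd_double /= cats0 cats1.
by rewrite uphalf_double doubleK.
Qed.

Lemma nth_insh j t : t < j.*2 ->
  nth 0 (insh_word j.*2) t = if odd t then t./2.+1 else j + t./2.+1.
Proof.
rewrite /insh_word odd_double cats0 doubleK.
suff gen k m i : i < k.*2 ->
    nth 0 (flatten [seq [:: j + i; i] | i <- iota m k]) i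
      = if odd i then m + i./2 else j + (m + i./2).
  by move=> /gen->; rewrite add1n.
elim: k m i => [|k IH] m [|[|i]] //= lt_i; rewrite ?addn0 //.
by rewrite IH ?negbK ?addSnnS.
Qed.

Lemma last_insh j : 0 < j -> last 0 (insh_word j.*2) = j.
Proof.
move=> j0; rewrite -nth_last (size_word (insh_is_word _)) nth_insh; last by lia.
rewrite (_ : odd j.*2.-1 = true); lia.
Qed.

Lemma insh_moves_last j : 0 < j -> last 0 (insh_word j.*2) != j.*2.
Proof. by move=> j0; rewrite last_insh //; lia. Qed.

Lemma insh_moves_last2 j : 1 < j ->
  nth 0 (insh_word j.*2) (last 0 (insh_word j.*2)).-1 != j.*2.
Proof.
by move=> j1; rewrite last_insh ?nth_insh; [case: ifP; lia | lia | lia].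
Qed.

Lemma monge_is_word n : monge_word n \in words n.
Proof. exact: word_of_method (card_Monge n). Qed.

Lemma monge_odd j : monge_word j.*2.+1 = rcons (monge_word j.*2) j.*2.+1.
Proof.
by rewrite /monge_word iota1_rcons !filter_rcons /= odd_double /= rcons_cat.
Qed.

Lemma monge_even j :
  monge_word j.+1.*2 = j.+1.*2 :: rcons (monge_word j.*2) j.*2.+1.
Proof.
rewrite doubleS /monge_word 2!iota1_rcons !filter_rcons /= negbK odd_double /=.
by rewrite rev_rcons /= rcons_cat.
Qed.

Lemma last_monge j : 0 < j -> last 0 (monge_word j.*2) = j.*2.-1.
Proof. by case: j => // j _; rewrite monge_even /= last_rcons. Qed.

Lemma monge_moves_last j : 0 < j -> last 0 (monge_word j.*2) != j.*2.
Proof. by move=> j0; rewrite last_monge //; lia. Qed.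

Lemma monge_moves_last2 j : 1 < j ->
  nth 0 (monge_word j.*2) (last 0 (monge_word j.*2)).-1 != j.*2.
Proof.
case: j => [|[|j]] // _; rewrite last_monge // monge_even.
have E : nth 0 (monge_word j.+1.*2) j.*2.+1 = j.*2.+1.
  rewrite -[RHS](@last_monge j.+1) // -nth_last.
  by rewrite (size_word (monge_is_word _)).
rewrite (_ : j.+2.*2.-1.-1 = j.*2.+1.+1) // [nth _ _ _]/= nth_rcons.
rewrite (size_word (monge_is_word _)) ifT; last by lia.
by rewrite [nth _ _ _]E; lia.
Qed.

Lemma nth_monge_mid j : 0 < j -> nth 0 (monge_word j.*2) j = 1.
Proof.
case: j => // j _; elim: j => // j IH; rewrite monge_even /=.
rewrite nth_rcons (size_word (monge_is_word _)) ifT ?IH //; lia.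
Qed.

Lemma nth_shuffle_monge0 j e : 0 < j -> size e = j.*2 ->
  nth 0 (shuffle monge_word e) 0 = last 0 e.
Proof.
case: j => // j _ se; rewrite nth_shuffle ?se //; last exact: monge_is_word.
by rewrite monge_even /= -nth_last se.
Qed.

(** Two Monge shuffles bring the last letter to position j+1 through position
1, and the last but one to position 1 through the last position; in a
sorted result they are therefore j+1 and 1.  The last but one letter of the
device is the last but one of [w], since it was pushed at an odd time. *)
Lemma sorted_after2_tail j (w : seq nat) :
  1 < j -> w \in words j.*2 -> sorted_after monge_word 2 w ->
  exists w0, w = rcons (rcons w0 1) j.+1.
Proof.
move=> j1 ww /mapP[f fw /= Ef]; have sw := size_word ww; rewrite sw in Ef.
have sf : size f = j.*2 by rewrite (perm_size (perm_fresh monge_is_word fw)).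
have ssf : size (shuffle monge_word f) = j.*2.
  by rewrite size_shuffle //; apply: monge_is_word.
have Ex : last 0 w = j.+1.
  have := congr1 (nth 0 ^~ j) Ef; rewrite nth_iota; last by lia.
  rewrite nth_shuffle ?ssf; [|exact: monge_is_word|by lia].
  rewrite nth_monge_mid ?(ltnW j1) // (nth_shuffle_monge0 (ltnW j1) sf).
  by rewrite (last_fresh fw) add1n.
have Ey : nth 0 f j.*2.-2 = 1.
  have := congr1 (nth 0 ^~ 0) Ef; rewrite nth_iota; last by lia.
  rewrite (nth_shuffle_monge0 (ltnW j1) ssf) (last_shuffle monge_is_word sf).
  by rewrite last_monge ?(ltnW j1).
case/lastP: w ww fw sw Ex => [|w x] ww fw sw; first by rewrite /= in sw; lia.
rewrite last_rcons => Ex.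
case/lastP: w ww fw sw => [|w y] ww fw sw; first by rewrite /= in sw; lia.
exists w; rewrite Ex; congr (rcons (rcons _ _) _); rewrite -Ey.
move: fw sf; rewrite fresh_rcons => /mapP[d dw ->]; rewrite size_rcons => sd.
have szd : size d = j.*2.-1 by lia.
rewrite nth_rcons szd ifT; last by lia.
rewrite -szd nth_last (@last_devices_odd _ monge_is_word monge_odd j.-1 w y) //.
by move: sw; rewrite !size_rcons; move: (size w) => s; lia.
Qed.

(** An even Monge shuffle brings the last letter to the front, an odd one keeps
it at the end. *)
Lemma block_last w z : block monge_word (rcons w z) -> z = (size w).+1 \/ z = 1.
Proof.
move=> bw; have := odd_double_half (size w); move: (size w)./2 => j.
case: (odd (size w)) => /= szw; last first.
  move: bw; rewrite (block_odd monge_is_word monge_odd (j := j)) //.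
  by move=> /andP[/eqP -> _]; left; rewrite -szw.
move: bw; rewrite /block mem_cat size_rcons fresh_rcons => /orP[].
  by rewrite iota1_rcons mem_map_rcons => /andP[/eqP <- _]; left.
case/mapP => f /mapP[d dw Ef] E; right.
have sf : size f = j.+1.*2.
  rewrite Ef size_rcons (perm_size (perm_devices monge_is_word dw)).
  by rewrite -szw add1n doubleS.
by have := nth_shuffle_monge0 (ltn0Sn j) sf; rewrite -E Ef last_rcons.
Qed.

Lemma exceptional_tail_monge n v : v \in exceptional monge_word n ->
  exists j u w, [/\ 1 < j, size u + j.*2 = n, size w + 2 = j.*2 &
    v = rcons (rcons (dsum u w) (size u + 1)) (size u + j.+1)].
Proof.
move=> /mem_exceptional[j [u [w [/andP[j1 jn] wu ww /andP[_ p2] ->]]]].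
have [w0 Ew] := sorted_after2_tail j1 ww p2; exists j, u, w0; split=> //.
- by rewrite (size_word wu); lia.
- by rewrite -(size_word ww) Ew !size_rcons addn2.
- by rewrite Ew !dsum_rcons.
Qed.

(** Were [v] sortable, its last block would end with its minimum, the letter
[size u + j.+1], hence have j > 1 letters; but the letter just before,
[size u + 1], is smaller. *)
Lemma monge_unsortable n :
  {in exceptional monge_word n, forall v, ~~ sortable_word monge_word v}.
Proof.
move=> /= v /exceptional_tail_monge[j [u [w [j1 su sw Ev]]]].
apply/negP => /asboolP[k sk].
have szv : size v = size u + j.*2 by rewrite Ev !size_rcons size_dsum; lia.
inversion sk as [Ek E|k' u' w' su' w'0 bw' Ek E].
  by move: szv; rewrite -E /=; lia.
case/lastP: w' w'0 bw' E => // w1 z _ bz Ev'.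
have szv' : size v = size u' + (size w1).+1 by rewrite -Ev' size_dsum size_rcons.
have Elast : size u' + z = size u + j.+1.
  by have := congr1 (last 0) Ev'; rewrite Ev dsum_rcons !last_rcons.
have Epre : dsum u' w1 = rcons (dsum u w) (size u + 1).
  by move: Ev'; rewrite Ev dsum_rcons => /rcons_inj[].
case: (block_last bz) => Ez; first by lia.
case/lastP: w1 Epre szv' Elast {bz Ev' Ez} (Ez) => [|w2 y].
  by move=> _ /=; rewrite Ev !size_rcons size_dsum in szv *; lia.
rewrite dsum_rcons => /rcons_inj[_ Ey] _ El Ez; lia.
Qed.

(** The last letter of the direct sum is n + 1 - j, so it determines j. *)
Lemma exceptional_uniq n : uniq (exceptional monge_word n).
Proof.
apply: allpairs_uniq_dep => [|j _|]; first exact: iota_uniq.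
  by apply: allpairs_uniq => [||[? ?] [? ?] _ _ /= [-> ->]] //;
    rewrite filter_uniq ?words_uniq.
have tail j (q : seq nat * seq nat) : 1 < j < n./2.+1 ->
    q \in [seq (u, w) | u <- [seq u <- words (n - j.*2) | sortable_word monge_word u],
                        w <- [seq w <- words j.*2 | sorted_after monge_word 2 w]] ->
    last 0 (dsum q.1 q.2) + j = n.+1 /\ size q.1 = n - j.*2.
  move=> /andP[j1 jn] /allpairsP[[u w] /= [+ + ->]].
  rewrite !mem_filter => /andP[_ wu] /andP[p2 ww] /=; rewrite (size_word wu).
  have [w0 ->] := sorted_after2_tail j1 ww p2.
  by rewrite dsum_rcons last_rcons (size_word wu); lia.
move=> _ _ /allpairsPdep[j1 [q1 [jr1 qr1 ->]]]
  /allpairsPdep[j2 [q2 [jr2 qr2 ->]]] /= E.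
rewrite !mem_index_iota in jr1 jr2.
have [l1 s1] := tail _ _ jr1 qr1; have [l2 s2] := tail _ _ jr2 qr2.
have Ej : j1 = j2 by move: l1; rewrite E; lia.
rewrite -Ej in s2 *; have [] := dsum_inj (etrans s1 (esym s2)) E.
by case: q1 q2 {qr1 qr2 l1 l2 s1 s2 E} => [u1 w1] [u2 w2] /= -> ->.
Qed.

(** * The equality and the inequality *)

Unset Implicit Arguments.
Local Open Scope ring_scope.

Theorem theorem5p15 (n : nat) (hn : (1 <= n)%N) :
  (p' Monge n)%:R = (p Monge n.-1)%:R
     + 3%:R^-1 * \sum_(2 <= j < ((n - 1)./2).+1)
         (p1 Monge (2 * j + 1)%N)%:R * (p Monge (n - (2 * j + 1))%N)%:R :> rat
  /\
  (p' InSh n)%:R <= (p InSh n.-1)%:R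
     + 3%:R^-1 * \sum_(2 <= j < ((n - 1)./2).+1)
         (p1 InSh (2 * j + 1)%N)%:R * (p InSh (n - (2 * j + 1))%N)%:R :> rat.
Proof.
case: n hn => // n _; split.
  rewrite (third_of_sum monge_is_word monge_odd) //; first last.
  - exact: monge_moves_last2.
  - exact: monge_moves_last.
  rewrite -natrD.
  rewrite (p'_exact monge_is_word monge_odd monge_moves_last (exceptional_uniq n)) //.
  exact: monge_unsortable.
rewrite (third_of_sum insh_is_word insh_odd) //; first last.
- exact: insh_moves_last2.
- exact: insh_moves_last.
rewrite -natrD ler_nat.
exact: (p'_upper insh_is_word insh_odd insh_moves_last n).
Qed.
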